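(* Let $K$ be a field and let $I_{\mathcal A}\subset K[x_1,\dots,x_c,y_1,\dots,y_d]$ be the simplicial toric ideal defined by $\mathcal A\subseteq M_{\alpha,d}$. Then the maximum degree in a minimal Gröbner basis of $I_{\mathcal A}$ with respect to the reverse lexicographic order is at most $\max\{c,\ \alpha,\ c(\alpha-1)-1\}$, and moreover $$\max\{c,\ \alpha,\ c(\alpha-1)-1\}\ \le\ c(\alpha-1).$$
   Context: Setting. $K$ is an arbitrary field, $c\ge 2$, $\alpha\ge 2$ and $d$ are natural numbers, and $M_{\alpha,d}=\{(x_1,\dots,x_d)\in\mathbb N^d : x_1+\cdots+x_d=\alpha\}$ (with $0\in\mathbb N$). $\mathcal A=\{\mathbf e_1,\dots,\mathbf e_d,\mathbf a_1,\dots,\mathbf a_c\}\subseteq M_{\alpha,d}$ is a set of $d+c$ distinct elements, where $\mathbf e_1=(\alpha,0,\dots,0),\dots,\mathbf e_d=(0,\dots,0,\alpha)$. Writing $\mathbf a_i=(a_{i1},\dots,a_{id})$, the integers $a_{ij}$ ($1\le i\le c$, $1\le j\le d$) are assumed to be relatively prime (their overall gcd is $1$). $S\subseteq\mathbb N^d$ is the (homogeneous simplicial affine) semigroup (with $0$) generated by $\mathcal A$, and $K[S]\cong K[t_1^\alpha,\dots,t_d^\alpha,\mathbf t^{\mathbf a_1},\dots,\mathbf t^{\mathbf a_c}]\subseteq K[t_1,\dots,t_d]$, where $\mathbf t^{\mathbf a_i}=t_1^{a_{i1}}\cdots t_d^{a_{id}}$. $I_{\mathcal A}$ is the kernel of the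 $K$-algebra homomorphism $K[x_1,\dots,x_c,y_1,\dots,y_d]\to K[S]$, $x_i\mapsto \mathbf t^{\mathbf a_i}$, $y_j\mapsto t_j^\alpha$; it is called the simplicial toric ideal defined by $\mathcal A$. The grading is the standard one: $\deg x_i=\deg y_j=1$. Order. The reverse lexicographic order is the graded (degree) reverse lexicographic order with $x_1>\cdots>x_c>y_1>\cdots>y_d$. The maximum degree in a minimal Gröbner basis of $I_{\mathcal A}$ is the largest degree of a minimal generator of the initial ideal $\operatorname{in}(I_{\mathcal A})$. *)

(* Defs.v *)
From HB Require Import structures.
From mathcomp Require Import all_boot all_order all_algebra.
From mathcomp.multinomials Require Import mpoly.

Set Implicit Arguments.
Unset Strict Implicit.
Unset Printing Implicit Defensive.

Import GRing.Theory.

Local Open Scope ring_scope.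

(* Graded reverse lexicographic order on 'X_{1..n}, with
   'X_0 > 'X_1 > ... > 'X_(n-1): in equal degree, the smaller monomial is the
   one with the larger exponent at the last index where the two differ. *)
Definition grevlex_lt n (m1 m2 : 'X_{1..n}) : bool :=
  (mdeg m1 < mdeg m2)%N ||
  (mdeg m1 == mdeg m2) &&
    [exists i : 'I_n, (m2 i < m1 i)%N &&
       [forall j : 'I_n, (i < j)%N ==> (m1 j == m2 j)]].

(* The zero polynomial has no leading monomial. *)
Definition is_lead_monomial n (K : fieldType) (p : {mpoly K[n]})
    (m : 'X_{1..n}) : Prop :=
  m \in msupp p /\
  (forall m', m' \in msupp p -> m' != m -> grevlex_lt m' m).

Definition ideal_span (R : nzRingType) (P : R -> Prop) (f : R) : Prop :=
  exists s : seq (R * R),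
    (forall u, u \in s -> P u.2) /\ f = \sum_(u <- s) u.1 * u.2.

(* For a set P of polynomials, not necessarily an ideal: the ideal generated
   by the leading monomials of the nonzero elements of P. *)
Definition initial_ideal n (K : fieldType) (P : {mpoly K[n]} -> Prop) :
    {mpoly K[n]} -> Prop :=
  ideal_span (fun f => exists g, P g /\
    exists m, is_lead_monomial g m /\ f = 'X_[m]).

(* Minimality is irredundancy of the leading monomials; leading coefficients
   are not required to be 1. *)
Definition minimal_groebner_basis n (K : fieldType)
    (I : {mpoly K[n]} -> Prop) (G : seq {mpoly K[n]}) : Prop :=
  [/\ forall g, g \in G -> I g /\ g != 0,
      forall f, initial_ideal I f <-> initial_ideal (fun g => g \in G) f &
      forall g m, g \in G -> is_lead_monomial g m ->
        ~ initial_ideal (fun h => h \in rem g G) 'X_[m]].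

(* [msize p] is one plus the total degree of p. *)
Definition max_degree n (K : fieldType) (G : seq {mpoly K[n]}) : nat :=
  \max_(g <- G) (msize g).-1.

(* For a monomial ideal J; the order on monomials is divisibility. *)
Definition minimal_generator n (K : fieldType) (J : {mpoly K[n]} -> Prop)
    (m : 'X_{1..n}) : Prop :=
  J 'X_[m] /\ (forall m' : 'X_{1..n}, J 'X_[m'] -> (m' <= m)%MM -> m' = m).

Definition max_minimal_generator_degree n (K : fieldType)
    (J : {mpoly K[n]} -> Prop) (D : nat) : Prop :=
  (exists m : 'X_{1..n}, minimal_generator J m /\ mdeg m = D) /\
  (forall m : 'X_{1..n}, minimal_generator J m -> (mdeg m <= D)%N).

(* The family (a_1, ..., a_c, e_1, ..., e_d), with e_j = alpha times the j-th
   unit vector. *)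
Definition simplicial_generators c d (alpha : nat) (a : 'I_c -> 'X_{1..d})
    (k : 'I_(c + d)) : 'X_{1..d} :=
  match split k with
  | inl i => a i
  | inr j => (U_(j) *+ alpha)%MM
  end.

(* In {mpoly K[c + d]} the first c variables are x_1, ..., x_c and the last d
   are y_1, ..., y_d. K[S] is a subalgebra of K[t_1, ..., t_d], so the map is
   taken with values in the latter. *)
Definition toric_map (K : fieldType) c d (alpha : nat) (a : 'I_c -> 'X_{1..d})
    (p : {mpoly K[c + d]}) : {mpoly K[d]} :=
  comp_mpoly [tuple 'X_[simplicial_generators alpha a k] | k < c + d] p.

Definition simplicial_toric_ideal (K : fieldType) c d (alpha : nat)
    (a : 'I_c -> 'X_{1..d}) (p : {mpoly K[c + d]}) : Prop :=
  toric_map alpha a p = 0.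

(* Main.v *)
Require Import Defs.
From mathcomp Require Import all_boot all_order all_algebra.
From mathcomp.multinomials Require Import mpoly.
From mathcomp Require Import zify.

Set Implicit Arguments.
Unset Strict Implicit.
Unset Printing Implicit Defensive.

(** The toric ideal is spanned by the differences of monomials with the same
    image t^e, so a monomial m lies in its initial ideal exactly when some
    grevlex-smaller monomial has the same image (nonstandard_initial_ideal).
    Thus only exponents matter, and the degrees occurring in a minimal Groebner
    basis, homogeneous or not, are those of the minimal nonstandard monomials
    (minimal_groebner_max_degree; the order being graded, a leading monomial
    carries the degree of its polynomial).

    Let m = x^u y^v be such a minimal monomial and m' = x^u' y^v' the smallest
    monomial with the same image. By minimality m and m' are coprime. Each
    x_i^alpha is nonstandard, because x_i^alpha and y^(a_i) have the same image
    and a monomial in the y's is smaller than one in the x's. Hence u'_i < alpha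
    for all i, and either m = x_i^alpha, of degree alpha, or u_i < alpha for
    all i. At a coordinate j with v_j > 0 there is no y_j in m', so
    alpha v_j <= sum_i a_ij u'_i; summing over j gives |v| <= |u'|, and
    |v'| <= |u| in the same way (simplicial_balance). Since u and u' have
    disjoint supports,
    deg m = |u| + |v| <= |u| + |u'| <= c (alpha - 1).

    For alpha = 2 this is the bound c. For alpha >= 3 equality must be excluded.
    If deg m = c (alpha - 1), all the inequalities above are equalities: every
    nonzero u_i is alpha - 1, and alpha v'_j = (alpha - 1) sum_(u_i > 0) a_ij
    for all j. As alpha is prime to alpha - 1, it divides sum_(u_i > 0) a_ij, so
    the squarefree monomial w = prod_(u_i > 0) x_i has the image of a monomial
    in the y's. If w is not 1, it is nonstandard and divides m properly, against
    minimality. If w = 1, then m is a monomial in the y's and m' one in the x's,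
    so that m < m', a contradiction. *)

(** * The graded reverse lexicographic order *)

Lemma seq_max_exists (T : eqType) (r : rel T) (s : seq T) x0 :
    transitive r -> (forall x y, x != y -> r x y || r y x) -> x0 \in s ->
  exists2 x, x \in s & forall y, y \in s -> y != x -> r y x.
Proof.
move=> r_trans r_total; elim: s x0 => // z s IHs x0 _.
case: s IHs => [|z' s] IHs.
  by exists z; rewrite ?mem_head // => y; rewrite inE => /eqP->; rewrite eqxx.
have [x xs x_max] := IHs z' (mem_head _ _).
have [zx|x_neq_z] := eqVneq z x.
  by exists x => [|y]; rewrite inE ?xs ?orbT // zx => /predU1P[->|/x_max//];
    rewrite eqxx.
case/orP: (r_total _ _ x_neq_z) => [rzx|rxz].
  by exists x => [|y]; rewrite inE ?xs ?orbT // => /predU1P[->|/x_max].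
exists z => [|y]; rewrite inE ?eqxx // => /predU1P[->|ys _]; first by rewrite eqxx.
have [->//|y_neq_x] := eqVneq y x.
exact: r_trans (x_max y ys y_neq_x) rxz.
Qed.

Section Grevlex.

Variable n : nat.
Implicit Types m : 'X_{1..n}.

Lemma grevlexP m1 m2 :
  reflect (mdeg m1 < mdeg m2 \/ mdeg m1 = mdeg m2 /\
             exists2 i, m2 i < m1 i & forall j : 'I_n, i < j -> m1 j = m2 j)
          (grevlex_lt m1 m2).
Proof.
apply: (iffP orP) => [[->|/andP[/eqP-> /existsP[i /andP[lt_i /forallP eq_i]]]]|].
- by left.
- right; split=> //; exists i => // j lt_ij.
  by apply/eqP; move: (eq_i j); rewrite lt_ij.
- case=> [->|[-> [i lt_i eq_i]]]; [by left | right]; rewrite eqxx /=.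
  apply/existsP; exists i; rewrite lt_i /=.
  by apply/forallP=> j; apply/implyP=> /eq_i->.
Qed.

Lemma grevlex_irr m : grevlex_lt m m = false.
Proof.
by apply/negP=> /grevlexP[|[_ [i]]]; rewrite ltnn.
Qed.

Lemma grevlex_mdeg m1 m2 : grevlex_lt m1 m2 -> mdeg m1 <= mdeg m2.
Proof. by case/grevlexP=> [/ltnW|[->]]. Qed.

Lemma grevlex_trans : transitive (@grevlex_lt n).
Proof.
move=> m2 m1 m3 /grevlexP[lt12|[eq12 [i lt_i eq_i]]]
                /grevlexP[lt23|[eq23 [j lt_j eq_j]]]; apply/grevlexP.
- by left; apply: ltn_trans lt23.
- by left; rewrite -eq23.
- by left; rewrite eq12.
right; split; first by rewrite eq12.
have [lt_ij|lt_ji|/val_inj eq_ij] := ltngtP i j.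
- exists j => [|k lt_jk]; first by rewrite eq_i.
  by rewrite eq_i ?eq_j //; apply: ltn_trans lt_jk.
- exists i => [|k lt_ik]; first by rewrite -eq_j.
  by rewrite eq_i ?eq_j //; apply: ltn_trans lt_ik.
exists i => [|k lt_ik].
  by rewrite eq_ij; apply: ltn_trans lt_j _; rewrite -eq_ij.
by rewrite eq_i ?eq_j // -eq_ij.
Qed.

(** At equal degree the comparison is decided at the last index where the two
    exponents differ. *)
Lemma grevlex_total m1 m2 :
  m1 != m2 -> grevlex_lt m1 m2 || grevlex_lt m2 m1.
Proof.
move=> neq12; have [lt12|lt21|eq12] := ltngtP (mdeg m1) (mdeg m2).
- by apply/orP; left; apply/grevlexP; left.
- by apply/orP; right; apply/grevlexP; left.
have /existsP[i0 neq0] : [exists i, m1 i != m2 i].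
  apply: contraNT neq12 => /existsPn eqm.
  by apply/eqP/mnmP=> i; apply/eqP; move: (eqm i); rewrite negbK.
case: (@arg_maxnP _ i0 [pred i | m1 i != m2 i] (fun i : 'I_n => i : nat) neq0)
  => i /= neq_i i_max.
have eq_gt (j : 'I_n) : i < j -> m1 j = m2 j.
  move=> lt_ij; apply/eqP; apply: contraLR lt_ij => /i_max.
  by rewrite -leqNgt.
have [lt_i|lt_i|eq_i] := ltngtP (m1 i) (m2 i).
- apply/orP; right; apply/grevlexP; right; split=> //.
  by exists i => // j /eq_gt.
- by apply/orP; left; apply/grevlexP; right; split=> //; exists i.
by rewrite eq_i eqxx in neq_i.
Qed.

Lemma grevlex_add2r m m1 m2 :
  grevlex_lt (m1 + m)%MM (m2 + m)%MM = grevlex_lt m1 m2.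
Proof.
rewrite /grevlex_lt !mdegD ltn_add2r eqn_add2r; congr (_ || _).
congr (_ && _); apply: eq_existsb => i; rewrite !mnmDE ltn_add2r.
by congr (_ && _); apply: eq_forallb => j; rewrite !mnmDE eqn_add2r.
Qed.

End Grevlex.

(** * Leading monomials and initial ideals *)

Section LeadMonomial.

Variables (n : nat) (K : fieldType).
Implicit Types (p : {mpoly K[n]}) (m : 'X_{1..n}).

Lemma lead_monomial_exists p : p != 0%R -> exists m, is_lead_monomial p m.
Proof.
rewrite -msupp_eq0; case supp_p: (msupp p) => [//|m0 s] _.
have m0p : m0 \in msupp p by rewrite supp_p mem_head.
have [m mp m_max] := seq_max_exists (@grevlex_trans n) (@grevlex_total n) m0p.
by exists m.
Qed.

(** Holds for non-homogeneous polynomials because the order is graded. *)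
Lemma lead_monomial_degree p m :
  is_lead_monomial p m -> (msize p).-1 = mdeg m.
Proof.
case=> mp m_max; suff -> : msize p = (mdeg m).+1 by [].
apply/eqP; rewrite eqn_leq (msize_mdeg_lt mp) andbT msizeE.
apply/bigmax_leqP_seq => m' m'p _; rewrite ltnS.
by have [->//|/(m_max _ m'p)/grevlex_mdeg] := eqVneq m' m.
Qed.

(** The ideal generated by a set of monomials contains only the monomials
    divisible by one of them: in a combination equal to X^m, some summand must
    have a nonzero coefficient at m. *)
Lemma initial_idealX (P : {mpoly K[n]} -> Prop) m :
  initial_ideal P 'X_[m] <->
  exists g m', [/\ P g, is_lead_monomial g m' & (m' <= m)%MM].
Proof.
split=> [[s [Ps Xm]]|[g [m' [Pg lead_g le_m']]]]; last first.
  exists [:: ('X_[m - m'], 'X_[m'])]; split=> [u|]; last first.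
    by rewrite big_seq1 -mpolyXD submK.
  by rewrite inE => /eqP->; exists g; split=> //; exists m'.
have : ('X_[K, m]@_m)%R != 0%R by rewrite mcoeffX eqxx GRing.oner_eq0.
rewrite Xm GRing.raddf_sum /= => sum_neq0.
have [u us u_neq0] : exists2 u, u \in s & ((u.1 * u.2)@_m)%R != 0%R.
  apply/hasP; apply: contraNT sum_neq0 => /hasPn u_eq0.
  by rewrite big_seq big1 // => u /u_eq0; rewrite negbK => /eqP.
have [g [Pg [m' [lead_g u2E]]]] := Ps u us; exists g, m'; split=> //.
move: u_neq0; rewrite -mcoeff_msupp u2E => /msuppM_le/allpairsP[[m1 m2] /=].
by case=> _; rewrite msuppX inE => /eqP-> ->; apply: lem_addl.
Qed.

End LeadMonomial.

(** * Minimal generators and minimal Groebner bases *)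

Section MinimalMonomials.

Variable n : nat.
Implicit Types (m : 'X_{1..n}) (P : pred 'X_{1..n}).

Definition upward_closed P := forall m m', P m -> (m <= m')%MM -> P m'.

(** For an upward closed P it is enough to test the immediate divisors
    m / x_k, which makes divisibility-minimality decidable. *)
Definition minimal_in P m : bool :=
  P m && [forall k : 'I_n, (0 < m k) ==> ~~ P (m - U_(k))%MM].

Lemma subU_lt m (k : 'I_n) : 0 < m k -> mdeg (m - U_(k))%MM < mdeg m.
Proof.
move=> mk; have Um : (U_(k) <= m)%MM by rewrite lep1mP -lt0n.
by rewrite -[in X in _ < X](submK Um) mdegD mdeg1 addn1.
Qed.

Lemma minimal_inP P m : upward_closed P ->
  reflect (P m /\ forall m', P m' -> (m' <= m)%MM -> m' = m)
          (minimal_in P m).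
Proof.
move=> P_up; apply: (iffP andP) => [[Pm /forallP m_min]|[Pm m_min]]; split=> //.
  move=> m' Pm' le_m'; apply/eqP; apply/negP => /negP neq_m.
  have /existsP[k lt_k] : [exists k, m' k < m k].
    apply: contraNT neq_m => /existsPn ge_m'; apply/eqP/mnmP=> k; apply/eqP.
    by rewrite eqn_leq (mnm_lepP le_m') leqNgt ge_m'.
  have := m_min k; rewrite (leq_ltn_trans _ lt_k) //= => /negP; apply.
  apply: P_up Pm' _; apply/mnm_lepP=> i; rewrite mnmBE mnm1E.
  have [<-|_] := eqVneq k i; first by rewrite leq_subRL ?add1n // (leq_ltn_trans _ lt_k).
  by rewrite subn0 (mnm_lepP le_m').
apply/forallP=> k; apply/implyP=> mk; apply/negP=> /m_min/(_ (lem_subr _ _)) mE.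
by have := subU_lt mk; rewrite mE ltnn.
Qed.

Lemma minimal_below P m : P m -> exists2 m0, minimal_in P m0 & (m0 <= m)%MM.
Proof.
have [N] := ubnP (mdeg m); elim: N m => // N IHN m lt_mN Pm.
have [m_min|] := boolP (minimal_in P m); first by exists m; rewrite ?lepm_refl.
rewrite /minimal_in Pm => /forallPn[k]; rewrite negb_imply negbK => /andP[mk Pmk].
have [|m0 m0_min le_m0] := IHN _ _ Pmk.
  exact: leq_trans (subU_lt mk) lt_mN.
by exists m0 => //; apply: lepm_trans le_m0 (lem_subr _ _).
Qed.

End MinimalMonomials.

Section MinimalGroebnerBasis.

Variables (n : nat) (K : fieldType) (I : {mpoly K[n]} -> Prop).
(* Assuming that membership of monomials in the initial ideal is decidable
   lets minimal generators be found by a finite search. *)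
Variable P : pred 'X_{1..n}.
Hypothesis in_I : forall m, initial_ideal I 'X_[m] <-> P m.

Lemma initial_ideal_upward_closed : upward_closed P.
Proof.
move=> m m' /in_I/initial_idealX[g [m1 [Ig lead_g le_m1]]] le_mm'.
apply/in_I/initial_idealX; exists g, m1; split=> //.
exact: lepm_trans le_m1 le_mm'.
Qed.

Lemma minimal_generatorP m :
  reflect (minimal_generator (initial_ideal I) m) (minimal_in P m).
Proof.
apply: (iffP (minimal_inP m initial_ideal_upward_closed)).
  by case=> Pm m_min; split=> [|m' /in_I]; [apply/in_I | apply: m_min].
by case=> /in_I Pm m_min; split=> // m' /in_I; apply: m_min.
Qed.

(** A minimal generator of in(I) is divisible by some leading monomial of G, and
    minimality makes them equal. Conversely, if the leading monomial of g in G
    were not a minimal generator, a minimal generator dividing it would be the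
    leading monomial of another element h of G, against irredundancy. *)
Lemma minimal_groebner_lead G : minimal_groebner_basis I G ->
  (forall g m, g \in G -> is_lead_monomial g m -> minimal_in P m) /\
  (forall m, minimal_in P m -> exists2 g, g \in G & is_lead_monomial g m).
Proof.
case=> GI in_G G_irr.
have lead_min m : minimal_in P m ->
    exists2 g, g \in G & is_lead_monomial g m.
  move=> /(minimal_inP _ initial_ideal_upward_closed)[Pm m_min].
  have /in_G/initial_idealX[g [m' [Gg lead_g le_m']]] := (in_I m).2 Pm.
  have Pm' : P m'.
    apply/in_I/initial_idealX; exists g, m'; split; rewrite ?lepm_refl //.
    by have [] := GI g Gg.
  by exists g => //; rewrite -(m_min m').
split=> // g m Gg lead_g.
have Pm : P m.
  apply/in_I/initial_idealX; exists g, m; split; rewrite ?lepm_refl //.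
  by have [] := GI g Gg.
have [m0 m0_min le_m0] := minimal_below Pm.
have [h Gh lead_h] := lead_min m0 m0_min.
have [h_eq|h_neq] := eqVneq h g; last first.
  case: (G_irr g m Gg lead_g); apply/initial_idealX; exists h, m0; split=> //.
  exact: rem_mem.
suff -> : m = m0 by [].
rewrite h_eq in lead_h; apply/eqP/negP => /negP neq_m.
(* Two different leading monomials of g would each be smaller than the other. *)
have lt_m := lead_h.2 m lead_g.1 neq_m.
have := lead_g.2 m0 lead_h.1; rewrite eq_sym => /(_ neq_m) lt_m0.
by have := grevlex_trans lt_m lt_m0; rewrite grevlex_irr.
Qed.

Lemma minimal_groebner_max_degree B :
    (exists m, P m) -> (forall m, minimal_in P m -> mdeg m <= B) ->
  exists D, [/\ max_minimal_generator_degree (initial_ideal I) D,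
    forall G, minimal_groebner_basis I G -> max_degree G = D & D <= B].
Proof.
move=> [m1 Pm1] degB; have [m0 m0_min _] := minimal_below Pm1.
pose A := [pred m : 'X_{1..n < B.+1} | minimal_in P m].
have A_gt0 : 0 < #|A|.
  have lt_m0 : mdeg m0 < B.+1 by rewrite ltnS degB.
  by apply/card_gt0P; exists (BMultinom lt_m0); rewrite inE.
have [mD mD_min max_mD] := eq_bigmax_cond (fun m : 'X_{1..n < B.+1} => mdeg m) A_gt0.
have mD_max m : minimal_in P m -> mdeg m <= mdeg mD.
  move=> m_min; have lt_m : mdeg m < B.+1 by rewrite ltnS degB.
  by rewrite -max_mD (leq_bigmax_cond (BMultinom lt_m)).
exists (mdeg mD); split; last exact: degB.
  split=> [|m /minimal_generatorP/mD_max//].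
  by exists mD; split=> //; apply/minimal_generatorP.
move=> G GB; have [lead_in lead_ex] := minimal_groebner_lead GB.
apply/eqP; rewrite eqn_leq; apply/andP; split.
  apply/bigmax_leqP_seq=> g Gg _; have [GI _ _] := GB.
  have [m lead_g] := lead_monomial_exists (GI g Gg).2.
  by rewrite (lead_monomial_degree lead_g) mD_max ?(lead_in g).
have [g Gg lead_g] := lead_ex _ mD_min.
rewrite -(lead_monomial_degree lead_g).
exact: (@leq_bigmax_seq _ G xpredT (fun h => (msize h).-1)).
Qed.

End MinimalGroebnerBasis.

(** * Standard monomials of a toric ideal *)

Section ToricFibres.

Variables (K : fieldType) (n d : nat) (gens : 'I_n -> 'X_{1..d}).
Implicit Types m : 'X_{1..n}.

Definition toric_exponent m : 'X_{1..d} :=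
  [multinom \sum_(k < n) gens k j * m k | j < d].

Definition toric_kernel (p : {mpoly K[n]}) : Prop :=
  comp_mpoly [tuple 'X_[gens k] | k < n] p = 0%R.

Lemma toric_exponentD m m' :
  toric_exponent (m + m') = (toric_exponent m + toric_exponent m')%MM.
Proof.
apply/mnmP=> j; rewrite mnmDE !mnmE -big_split; apply: eq_bigr => k _ /=.
by rewrite mnmDE mulnDr.
Qed.

Lemma comp_mpolyX_toric m :
  comp_mpoly [tuple 'X_[gens k] | k < n] 'X_[m] =
    'X_[toric_exponent m] :> {mpoly K[d]}.
Proof.
rewrite comp_mpolyX.
under eq_bigr do rewrite tnth_mktuple mpolyXn.
rewrite mprodXE; congr 'X_[_]; apply/mnmP=> j.
by rewrite mnmE mnm_sumE; apply: eq_bigr => k _; rewrite mulmnE.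
Qed.

(** The bound on the degree costs nothing, since a grevlex-smaller monomial
    never has larger degree, and it makes the search finite. *)
Definition nonstandard m : bool :=
  [exists m' : 'X_{1..n < (mdeg m).+1},
     grevlex_lt m' m && (toric_exponent m' == toric_exponent m)].

Lemma nonstandardP m :
  reflect (exists2 m', grevlex_lt m' m & toric_exponent m' = toric_exponent m)
          (nonstandard m).
Proof.
apply: (iffP existsP) => [[m' /andP[lt_m' /eqP eq_m']]|[m' lt_m' eq_m']].
  by exists m'.
have deg_m' : mdeg m' < (mdeg m).+1 by rewrite ltnS grevlex_mdeg.
by exists (BMultinom deg_m'); rewrite /= lt_m' eq_m' eqxx.
Qed.

Lemma nonstandard_upward_closed : upward_closed nonstandard.
Proof.
move=> m m1 /nonstandardP[m' lt_m' eq_m'] le_m1; apply/nonstandardP.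
rewrite -(submK le_m1) addmC; exists (m' + (m1 - m))%MM.
  by rewrite grevlex_add2r.
by rewrite !toric_exponentD eq_m'.
Qed.

(** The coefficient of the image of p at the image of m vanishes, so the
    contribution of the leading term m is cancelled by that of another term with
    the same image; as m is leading, that term is smaller. *)
Lemma lead_toric_nonstandard p m :
  toric_kernel p -> is_lead_monomial p m -> nonstandard m.
Proof.
move=> Ip [mp m_max]; apply/nonstandardP.
have : (\sum_(m' <- msupp p) p@_m' *
          (toric_exponent m' == toric_exponent m)%:R)%R = 0%R :> K.
  transitivity ((comp_mpoly [tuple 'X_[gens k] | k < n] p)
                  @_(toric_exponent m))%R; last by rewrite Ip mcoeff0.
  rewrite comp_mpolyEX GRing.raddf_sum /=; apply: eq_bigr => m' _.
  by rewrite mcoeffZ comp_mpolyX_toric mcoeffX.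
rewrite (bigD1_seq m) ?msupp_uniq //= eqxx GRing.mulr1 => sum_eq0.
have [m' m'p /andP[m'_neq /eqP m'_eq]] : exists2 m', m' \in msupp p &
    (m' != m) && (toric_exponent m' == toric_exponent m).
  apply/hasP; apply: contra_eqT sum_eq0 => /hasPn no_m'.
  rewrite big_seq_cond big1 ?GRing.addr0 -?mcoeff_msupp // => m'.
  case/andP=> /no_m'; case: eqP => //= _.
  by move=> /negbTE-> _; rewrite GRing.mulr0.
by exists m'; rewrite ?m_max.
Qed.

(** If m' < m has the same image as m, the binomial X^m - X^m' lies in the toric
    ideal and has leading monomial m. *)
Lemma nonstandard_initial_ideal m :
  initial_ideal toric_kernel 'X_[m] <-> nonstandard m.
Proof.
split=> [/initial_idealX[g [m1 [Ig lead_g le_m1]]]|/nonstandardP[m' lt_m' eq_m']].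
  exact: nonstandard_upward_closed (lead_toric_nonstandard Ig lead_g) le_m1.
apply/initial_idealX; exists ('X_[m] - 'X_[m'])%R, m; rewrite lepm_refl.
have neq_m' : m' != m.
  by apply: contraTneq lt_m' => ->; rewrite grevlex_irr.
split=> //.
  by rewrite /toric_kernel comp_mpolyB !comp_mpolyX_toric eq_m' GRing.subrr.
split=> [|m1 /msuppB_le].
  rewrite mcoeff_msupp mcoeffB !mcoeffX eqxx (negbTE neq_m').
  by rewrite GRing.subr0 GRing.oner_eq0.
by rewrite mem_cat !msuppX !inE => /orP[->|/eqP->].
Qed.

(** The normal form is the smallest monomial with the same image as m; those of
    degree at most deg m are finitely many. *)
Lemma nonstandard_normal_form m : nonstandard m ->
  exists m', [/\ grevlex_lt m' m, toric_exponent m' = toric_exponent m &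
                 ~~ nonstandard m'].
Proof.
move=> m_ns.
pose s := [seq val x | x <- enum {: 'X_{1..n < (mdeg m).+1}} &
                       toric_exponent (val x) == toric_exponent m].
have in_s x : mdeg x <= mdeg m -> toric_exponent x = toric_exponent m ->
    x \in s.
  move=> deg_x eq_x; apply/mapP; rewrite -ltnS in deg_x.
  by exists (BMultinom deg_x); rewrite // mem_filter /= eq_x eqxx mem_enum.
have ms := in_s m (leqnn _) erefl.
have gt_trans : transitive (fun x y : 'X_{1..n} => grevlex_lt y x).
  by move=> y x z lt_yx /grevlex_trans; apply.
have gt_total (x y : 'X_{1..n}) : x != y -> grevlex_lt y x || grevlex_lt x y.
  by rewrite orbC; apply: grevlex_total.
have [m0 /mapP[x0]] := seq_max_exists gt_trans gt_total ms.
rewrite mem_filter => /andP[/eqP eq_m0 _] m0E m0_min.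
have {x0 eq_m0 m0E} eq_m0 : toric_exponent m0 = toric_exponent m by rewrite m0E.
have m0_std : mdeg m0 <= mdeg m -> ~~ nonstandard m0.
  move=> deg_m0; apply/nonstandardP=> -[m1 lt_m1 eq_m1].
  have m1_neq : m1 != m0 by apply: contraTneq lt_m1 => ->; rewrite grevlex_irr.
  have deg_m1 := leq_trans (grevlex_mdeg lt_m1) deg_m0.
  have := m0_min m1 (in_s _ deg_m1 (etrans eq_m1 eq_m0)) m1_neq.
  by move/(grevlex_trans lt_m1); rewrite grevlex_irr.
have m_neq : m != m0.
  by apply: contraTneq m_ns => m_m0; rewrite m_m0 m0_std // -m_m0.
have lt_m0 := m0_min m ms m_neq.
by exists m0; split; rewrite ?m0_std ?grevlex_mdeg.
Qed.

(** A common variable could be cancelled from both monomials, which would make a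
    proper divisor of m nonstandard. *)
Lemma minimal_nonstandard_coprime m m' k :
    minimal_in nonstandard m ->
    grevlex_lt m' m -> toric_exponent m' = toric_exponent m ->
  (m k == 0) || (m' k == 0).
Proof.
case/andP=> _ /forallP/(_ k) m_min lt_m' eq_m'; rewrite -[_ || _]negbK negb_or -!lt0n.
apply/negP=> /andP[mk m'k]; move: m_min; rewrite mk => /nonstandardP; apply.
have Um : (U_(k) <= m)%MM by rewrite lep1mP -lt0n.
have Um' : (U_(k) <= m')%MM by rewrite lep1mP -lt0n.
exists (m' - U_(k))%MM; first by rewrite -(grevlex_add2r U_(k)%MM) !submK.
apply: (@addIm _ (toric_exponent U_(k)%MM)).
by rewrite -!toric_exponentD !submK.
Qed.

End ToricFibres.

(** * The degree bound for simplicial toric ideals *)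

Section SimplicialBound.

(** The hypotheses say that x^u y^v and x^u' y^v' have the same image and that
    no y_j divides both. Where v_j > 0, all of alpha v_j must come from u'. Since
    the rows of b sum to alpha, adding over j gives the inequality of degrees,
    and equality of the sums forces equality at each j. *)
Lemma simplicial_balance (c d alpha : nat) (b : 'I_c -> 'I_d -> nat)
    (u u' : 'I_c -> nat) (v v' : 'I_d -> nat) :
    0 < alpha -> (forall i, \sum_j b i j = alpha) ->
    (forall j, (v j == 0) || (v' j == 0)) ->
    (forall j, \sum_i b i j * u i + alpha * v j =
               \sum_i b i j * u' i + alpha * v' j) ->
  \sum_j v j <= \sum_i u' i /\
  (\sum_j v j = \sum_i u' i -> forall j, alpha * v j = \sum_i b i j * u' i).
Proof.
move=> alpha_gt0 b_row v_coprime balance.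
have v_le j : alpha * v j <= \sum_i b i j * u' i ?= iff
                (alpha * v j == \sum_i b i j * u' i).
  split=> //; case/orP: (v_coprime j) => /eqP v0; first by rewrite v0 muln0.
  by have := balance j; rewrite v0 muln0 addn0 => <-; apply: leq_addl.
have sum_b : \sum_j \sum_i b i j * u' i = alpha * \sum_i u' i.
  rewrite exchange_big big_distrr; apply: eq_bigr => i _ /=.
  by rewrite -big_distrl b_row.
have [sum_le sum_eq] := leqif_sum (fun j (_ : xpredT j) => v_le j).
rewrite sum_b -big_distrr /= in sum_le sum_eq; split.
  by rewrite -(leq_pmul2l alpha_gt0).
move=> eq_uv j; move: sum_eq; rewrite eq_uv eqxx => /esym/forallP/(_ j).
by move/eqP.
Qed.

Variables (c d alpha : nat) (a : 'I_c -> 'X_{1..d}).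
Hypotheses (alpha_gt0 : 0 < alpha) (a_deg : forall i, mdeg (a i) = alpha).

Local Notation gens := (simplicial_generators alpha a).
Implicit Types m : 'X_{1..c + d}.

Lemma simplicial_exponentE m j :
  toric_exponent gens m j =
    \sum_i a i j * m (lshift d i) + alpha * m (rshift c j).
Proof.
rewrite mnmE big_split_ord /=; congr (_ + _).
  by apply: eq_bigr => i _; rewrite /simplicial_generators (unsplitK (inl i)).
rewrite (bigD1 j) //= big1 ?addn0 => [|i neq_i];
  rewrite /simplicial_generators (unsplitK (inr _)) mulmnE mnm1E.
  by rewrite eqxx mul1n.
by rewrite (negbTE neq_i).
Qed.

Lemma simplicial_exponent_degree m :
  mdeg (toric_exponent gens m) = alpha * mdeg m.
Proof.
rewrite !mdegE; under eq_bigr do rewrite simplicial_exponentE.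
rewrite big_split exchange_big big_split_ord mulnDr -!big_distrr /=; congr (_ + _).
rewrite big_distrr; apply: eq_bigr => i _ /=.
by rewrite -big_distrl -mdegE a_deg.
Qed.

Lemma eq_simplicial_degree m m' :
  toric_exponent gens m = toric_exponent gens m' -> mdeg m = mdeg m'.
Proof.
move=> eq_mm'; apply/eqP; rewrite -(eqn_pmul2l alpha_gt0).
by rewrite -!simplicial_exponent_degree eq_mm'.
Qed.

(** The two monomials have the same positive degree. If m were the smaller one,
    then at the last index i where they differ m would have the larger exponent,
    so x_i divides m; all the y-exponents, coming after i, would agree, hence
    vanish, and m' would be 1. *)
Lemma y_monomial_lt_x_monomial m m' :
    m != 0%MM -> (forall j, m (rshift c j) = 0) ->
    (forall i, m' (lshift d i) = 0) ->
    toric_exponent gens m' = toric_exponent gens m ->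
  grevlex_lt m' m.
Proof.
move=> m_neq0 m_x m'_y eq_mm'; have deg_mm' := eq_simplicial_degree eq_mm'.
rewrite -mdeg_eq0 in m_neq0.
have neq_mm' : m != m'.
  apply: contra_neq m_neq0 => mE; rewrite mdegE big_split_ord /=.
  rewrite [X in _ + X]big1 ?addn0 => [|j _]; last exact: m_x.
  by apply: big1 => i _; rewrite mE m'_y.
case/orP: (grevlex_total neq_mm') => // /grevlexP[].
  by rewrite deg_mm' ltnn.
case=> _ [i lt_i eq_i]; move: deg_mm' m_neq0.
have [i1 i1E|i1 i1E] := split_ordP i; last by rewrite i1E m_x ltn0 in lt_i.
rewrite mdegE big_split_ord /= !big1 => [<-//|j _|j _]; last exact: m'_y.
by rewrite -eq_i ?m_x // i1E /= (leq_trans (ltn_ord i1)) ?leq_addr.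
Qed.

Definition xy_monomial (u : 'I_c -> nat) (v : 'I_d -> nat) : 'X_{1..c + d} :=
  [multinom match split k with inl i => u i | inr j => v j end | k < c + d].

Lemma xy_monomial_x u v i : xy_monomial u v (lshift d i) = u i.
Proof. by rewrite mnmE (unsplitK (inl i)). Qed.

Lemma xy_monomial_y u v j : xy_monomial u v (rshift c j) = v j.
Proof. by rewrite mnmE (unsplitK (inr j)). Qed.

(** The hypothesis on q says that x^u and y^q have the same image. *)
Lemma integral_x_monomial_nonstandard (u : 'I_c -> nat) (q : 'I_d -> nat) :
    (exists i, 0 < u i) -> (forall j, \sum_i a i j * u i = alpha * q j) ->
  nonstandard gens (xy_monomial u (fun=> 0)).
Proof.
move=> [i u_i] sum_a.
have eq_exp : toric_exponent gens (xy_monomial (fun=> 0) q) =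
              toric_exponent gens (xy_monomial u (fun=> 0)).
  apply/mnmP=> j; rewrite !simplicial_exponentE !xy_monomial_y muln0 addn0.
  rewrite big1 => [|i' _]; last by rewrite xy_monomial_x muln0.
  by rewrite add0n -sum_a; apply: eq_bigr => i' _; rewrite xy_monomial_x.
apply/nonstandardP; exists (xy_monomial (fun=> 0) q) => //.
apply: y_monomial_lt_x_monomial => // [|j|i'].
- apply: contraTneq u_i => /mnmP/(_ (lshift d i)).
  by rewrite xy_monomial_x mnm0E => ->.
- exact: xy_monomial_y.
- exact: xy_monomial_x.
Qed.

Lemma x_power_nonstandard i :
  nonstandard gens (xy_monomial (fun i' => alpha * (i == i')) (fun=> 0)).
Proof.
apply: (@integral_x_monomial_nonstandard _ (fun j => a i j)) => [|j].
  by exists i; rewrite eqxx muln1.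
rewrite (bigD1 i) //= eqxx muln1 big1 => [|i' neq_i].
  by rewrite addn0 mulnC.
by rewrite eq_sym (negbTE neq_i) !muln0.
Qed.

Lemma x_power_le m i : alpha <= m (lshift d i) ->
  (xy_monomial (fun i' => alpha * (i == i')) (fun=> 0%N) <= m)%MM.
Proof.
move=> ge_alpha; apply/mnm_lepP=> k.
have [k' ->|k' ->] := split_ordP k; last by rewrite xy_monomial_y.
rewrite xy_monomial_x; have [<-|_] := eqVneq i k'; first by rewrite muln1.
by rewrite muln0.
Qed.

Lemma standard_x_exponent m i :
  ~~ nonstandard gens m -> m (lshift d i) < alpha.
Proof.
apply: contraNltn => /x_power_le.
exact: nonstandard_upward_closed (x_power_nonstandard i).
Qed.

Lemma minimal_x_exponent m i :
    minimal_in (nonstandard gens) m ->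
  mdeg m = alpha \/ m (lshift d i) < alpha.
Proof.
move=> m_min; have [|/x_power_le le_m] := ltnP (m (lshift d i)) alpha.
  by right.
left; have [_ m_min'] := minimal_inP m (@nonstandard_upward_closed _ _ gens) m_min.
rewrite -(m_min' _ (x_power_nonstandard i) le_m).
rewrite mdegE big_split_ord /= [X in _ + X]big1 ?addn0 => [|j _]; last first.
  exact: xy_monomial_y.
under eq_bigr do rewrite xy_monomial_x.
rewrite (bigD1 i) //= eqxx muln1 big1 ?addn0 // => i' neq_i.
by rewrite eq_sym (negbTE neq_i) muln0.
Qed.

(** The argument bounds deg m by c (alpha - 1), then excludes equality when
    alpha >= 3. *)
Lemma minimal_nonstandard_degree m :
    minimal_in (nonstandard gens) m ->
  mdeg m <= maxn c (maxn alpha (c * (alpha - 1) - 1)).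
Proof.
move=> m_min; have [deg_m|deg_m] := eqVneq (mdeg m) alpha.
  by rewrite deg_m !leq_max leqnn orbT.
have u_lt i : m (lshift d i) < alpha.
  by case: (minimal_x_exponent i m_min) deg_m => // ->; rewrite eqxx.
have m_ns : nonstandard gens m by case/andP: m_min.
have [m' [lt_m' eq_m' m'_std]] := nonstandard_normal_form m_ns.
have u'_lt i := standard_x_exponent i m'_std.
have coprime_mm' k := minimal_nonstandard_coprime k m_min lt_m' eq_m'.
pose u i := m (lshift d i); pose u' i := m' (lshift d i).
pose v j := m (rshift c j); pose v' j := m' (rshift c j).
pose U := \sum_i u i; pose U' := \sum_i u' i.
pose V := \sum_j v j; pose V' := \sum_j v' j.
have deg_uv : mdeg m = U + V by rewrite mdegE big_split_ord.
have deg_uv' : mdeg m = U' + V'.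
  by rewrite -(eq_simplicial_degree eq_m') mdegE big_split_ord.
have a_row i : \sum_j a i j = alpha by rewrite -mdegE.
have balance j : \sum_i a i j * u i + alpha * v j =
                 \sum_i a i j * u' i + alpha * v' j.
  by rewrite -!simplicial_exponentE eq_m'.
have u_coprime i : (u i == 0) || (u' i == 0) := coprime_mm' (lshift d i).
have v_coprime j : (v j == 0) || (v' j == 0) := coprime_mm' (rshift c j).
have v'_coprime j : (v' j == 0) || (v j == 0) by rewrite orbC.
have V_le : V <= U'.
  by have [] := simplicial_balance alpha_gt0 a_row v_coprime balance.
have [V'_le V'_eq] : V' <= U /\
    (V' = U -> forall j, alpha * v' j = \sum_i a i j * u i).
  exact: simplicial_balance alpha_gt0 a_row v'_coprime
    (fun j => esym (balance j)).
have uu'_le i : u i + u' i <= alpha - 1 ?= iff (u i + u' i == alpha - 1).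
  split=> //; have := u_lt i; have := u'_lt i.
  rewrite -/(u i) -/(u' i) => lt_u' lt_u.
  by case/orP: (u_coprime i) => /eqP; lia.
have := leqif_sum (fun i (_ : xpredT i) => uu'_le i).
rewrite big_split /= sum_nat_const card_ord -/U -/U' => -[sum_le sum_eq].
have [alpha_small|alpha_ge3] := leqP alpha 2.
  rewrite leq_max; apply/orP; left.
  have : c * (alpha - 1) <= c * 1 by rewrite leq_mul2l; apply/orP; right; lia.
  lia.
rewrite !leq_max; apply/orP; right; apply/orP; right.
rewrite leqNgt; apply/negP=> deg_big.
have full i : u i + u' i = alpha - 1.
  apply/eqP; move: sum_eq.
  have -> : U + U' == c * (alpha - 1) by apply/eqP; lia.
  by move/esym/forallP/(_ i).
have v'E : forall j, alpha * v' j = \sum_i a i j * u i by apply: V'_eq; lia.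
(* The exponent of the squarefree monomial with the x-support of m. *)
pose w i : nat := 0 < u i.
have uE i : u i = w i * (alpha - 1).
  have := full i; rewrite /w.
  by case/orP: (u_coprime i) => /eqP ->; case: ltnP; lia.
have dvd_w j : alpha %| \sum_i a i j * w i.
  have cop : coprime alpha (alpha - 1) by rewrite subn1 coprimenP.
  rewrite -(Gauss_dvdl _ cop) big_distrl /=; apply/dvdnP; exists (v' j).
  by rewrite mulnC v'E; apply: eq_bigr => i _; rewrite uE mulnA.
have [/existsP[i0 u_i0]|/existsPn u0] := boolP [exists i, 0 < u i].
  have w_ns : nonstandard gens (xy_monomial w (fun=> 0)).
    apply: (@integral_x_monomial_nonstandard _
              (fun j => (\sum_i a i j * w i) %/ alpha)).
      by exists i0; rewrite /w u_i0.
    by move=> j; rewrite mulnC divnK.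
  have [_ m_min'] := minimal_inP m (@nonstandard_upward_closed _ _ gens) m_min.
  have w_le : (xy_monomial w (fun=> 0%N) <= m)%MM.
    apply/mnm_lepP=> k; have [k' ->|k' ->] := split_ordP k.
      by rewrite xy_monomial_x /w /u; case: (m _).
    by rewrite xy_monomial_y.
  (* Minimality gives m = x^w, whose exponent at i0 is 1, not alpha - 1. *)
  have := uE i0; rewrite /u -(m_min' _ w_ns w_le) xy_monomial_x /w u_i0; lia.
(* Here m is a monomial in the y's, and v' = 0 makes m' one in the x's. *)
have {}u0 i : u i = 0 by apply/eqP; rewrite -leqn0 leqNgt u0.
have v'0 j : v' j = 0.
  apply/eqP; rewrite -(eqn_pmul2l alpha_gt0) v'E muln0.
  by apply/eqP; apply: big1 => i _; rewrite u0 muln0.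
have := grevlex_irr m; rewrite (@grevlex_trans _ m' m m) //.
apply: y_monomial_lt_x_monomial => //.
rewrite -mdeg_eq0 -(eq_simplicial_degree (esym eq_m')); lia.
Qed.

End SimplicialBound.

Theorem theorem1p4 (K : fieldType) (c alpha d : nat) (a : 'I_c -> 'X_{1..d})
    (c_ge2 : 2 <= c) (alpha_ge2 : 2 <= alpha)
    (a_in_M : forall i : 'I_c, mdeg (a i) = alpha)
    (A_distinct : injective (simplicial_generators alpha a))
    (a_coprime :
       \big[gcdn/0]_(i < c) \big[gcdn/0]_(j < d) (a i j : nat) = 1) :
  (exists D : nat,
     [/\ max_minimal_generator_degree
           (initial_ideal (@simplicial_toric_ideal K c d alpha a)) D,
         (forall G : seq {mpoly K[c + d]},
            minimal_groebner_basis (@simplicial_toric_ideal K c d alpha a) G ->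
            max_degree G = D) &
         D <= maxn c (maxn alpha (c * (alpha - 1) - 1))]) /\
  maxn c (maxn alpha (c * (alpha - 1) - 1)) <= c * (alpha - 1).
Proof.
have alpha_gt0 : 0 < alpha by apply: ltnW.
split; last by rewrite !geq_max; apply/and3P; split; nia.
apply: (minimal_groebner_max_degree
          (nonstandard_initial_ideal K (simplicial_generators alpha a))).
  pose i0 : 'I_c := Ordinal (ltnW c_ge2).
  by eexists; apply: (x_power_nonstandard alpha_gt0 a_in_M i0).
exact: minimal_nonstandard_degree.
Qed.
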